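(* Let $H=(V,E)$ be a partition-connected hypergraph with $|V|\ge2$. Then $H$ is homogeneous (i.e. the optimal density $\eta^*$ of $\operatorname{Mod}_2(\widehat\Gamma(H))$ is a constant vector, where $\Gamma(H)$ is the hypertree family of $H$) if and only if its strength coincides with its fractional arboricity, i.e. $S(H)=D(H)$.
   Context: A hypergraph $H=(V,E)$ has a finite nonempty vertex set $V$ and a finite collection $E$ of subsets of $V$ (hyperedges), where repetitions are allowed (parallel hyperedges are distinct elements of $E$) and every hyperedge has at least two vertices. For $X\subseteq V$, $E[X]$ is the set of hyperedges contained in $X$. For a partition $\mathscr P$ of $V$ into nonempty parts, $|\mathscr P|$ is the number of parts and $\delta(\mathscr P)$ is the set of hyperedges intersecting at least two parts. $H$ is partition-connected if $|\delta(\mathscr P)|\ge|\mathscr P|-1$ for every partition $\mathscr P$ of $V$. Strength: $S(H)=\min\left\{\frac{|\delta(\mathscr P)|}{|\mathscr P|-1}:\mathscr P\text{ a partition of }V,\ |\mathscr P|\ge2\right\}$. Fractional arboricity: $D(H)=\max\left\{\frac{|E[X]|}{|X|-1}:X\subseteq V,\ |X|\ge2\right\}$. A set $F\subseteq E$ is a hyperforest if for every nonempty $X\subseteq V$ at most $|X|-1$ hyperedges of $F$ are contained in $X$; a hypertree is a hyperforest with $|F|=|V|-1$. The hypertree family $\Gamma(H)$ is the family of all hypertrees of $H$, each identified with its indicator vector in $\mathbb{R}^E_{\ge 0}$. For a family $\Gamma\subset\mathbb{R}^E_{\ge0}$, $\operatorname{Adm}(\Gamma)=\{\rho\in\mathbb{R}^E_{\ge0}:\gamma^T\rho\ge1\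 \forall\gamma\in\Gamma\}$; the Fulkerson blocker family $\widehat\Gamma$ is the set of extreme points of $\operatorname{Adm}(\Gamma)$; $\operatorname{Mod}_2(\Gamma)=\inf_{\rho\in\operatorname{Adm}(\Gamma)}\sum_{e\in E}\rho(e)^2$, and its optimal density is the unique minimizer. *)

(* Defs.v *)
From HB Require Import structures.
From mathcomp Require Import all_boot all_order all_algebra.
From mathcomp Require Import reals.

Set Implicit Arguments.
Unset Strict Implicit.
Unset Printing Implicit Defensive.
Import Order.TTheory GRing.Theory Num.Theory.
Local Open Scope ring_scope.

(* Hyperedges form an abstract finite type, so that parallel hyperedges are
   distinct elements of [hedge] with the same value of [ends]. *)
Record hypergraph := Hypergraph {
  vertex : finType;
  hedge : finType;
  ends : hedge -> {set vertex};
  vertex_gt0 : (0 < #|vertex|)%N;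
  ends_ge2 : forall e, (2 <= #|ends e|)%N
}.

Section Combinatorics.
Variable H : hypergraph.
Implicit Types (X : {set vertex H}) (P : {set {set vertex H}})
  (F : {set hedge H}).

Definition induced_edges X : {set hedge H} := [set e | ends e \subset X].

Definition crossing_edges P : {set hedge H} :=
  [set e | (2 <= #|[set A in P | A :&: ends e != set0]|)%N].

Definition partition_connected : Prop :=
  forall P, partition P [set: vertex H] ->
    (#|P|.-1 <= #|crossing_edges P|)%N.

Definition hyperforest F : Prop :=
  forall X, X != set0 -> (#|F :&: induced_edges X| <= #|X|.-1)%N.

Definition hypertree F : Prop := hyperforest F /\ #|F| = #|vertex H|.-1.

Definition singletons : {set {set vertex H}} := [set [set x] | x : vertex H].

Lemma singletons_partition : partition singletons [set: vertex H].
Proof.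
have := preim_partitionP id [set: vertex H]; congr (partition _ _).
rewrite /preim_partition /equivalence_partition /singletons.
apply/setP => A; apply/imsetP/imsetP => -[x _ ->]; exists x => //;
  by apply/setP => y; rewrite !inE /= eq_sym.
Qed.

Lemma card_singletons : #|singletons| = #|vertex H|.
Proof. by rewrite card_imset //; exact: set1_inj. Qed.

Section Ratios.
Variable R : realType.

Definition cut_ratio P : R := #|crossing_edges P|%:R / (#|P|%:R - 1).

Definition density_ratio X : R := #|induced_edges X|%:R / (#|X|%:R - 1).

(* The witnesses [singletons] and [[set: vertex H]] required by [arg min] and
   [arg max] are admissible exactly when [1 < #|vertex H|]; then the values are
   a true minimum and a true maximum, see [strengthP] and
   [frac_arboricityP]. *)
Definition strength : R :=
  cut_ratio [arg min_(P < singletons |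
    partition P [set: vertex H] && (2 <= #|P|)%N) cut_ratio P]%O.

Definition frac_arboricity : R :=
  density_ratio [arg max_(X > [set: vertex H] | (2 <= #|X|)%N)
    density_ratio X]%O.

Lemma strengthP : (2 <= #|vertex H|)%N ->
  (exists P, [/\ partition P [set: vertex H], (2 <= #|P|)%N &
     strength = cut_ratio P]) /\
  (forall P, partition P [set: vertex H] -> (2 <= #|P|)%N ->
     strength <= cut_ratio P).
Proof.
move=> V2; rewrite /strength; case: arg_minP => [|P /andP[pP P2] minP].
  by rewrite singletons_partition card_singletons.
by split=> [|Q pQ Q2]; [exists P | apply: minP; rewrite pQ Q2].
Qed.

Lemma frac_arboricityP : (2 <= #|vertex H|)%N ->
  (exists X, (2 <= #|X|)%N /\ frac_arboricity = density_ratio X) /\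
  (forall X, (2 <= #|X|)%N -> density_ratio X <= frac_arboricity).
Proof.
move=> V2; rewrite /frac_arboricity; case: arg_maxP => [|X X2 maxX].
  by rewrite cardsT.
by split=> [|Y Y2]; [exists X | exact: maxX].
Qed.

End Ratios.
End Combinatorics.

From mathcomp Require Import classical_sets.

Section Modulus.
Variables (R : realType) (E : finType).
Implicit Types (rho eta gamma : {ffun E -> R}) (Gamma : set {ffun E -> R}).

Definition dotf gamma rho : R := \sum_e gamma e * rho e.

Definition adm Gamma : set {ffun E -> R} :=
  [set rho : {ffun E -> R} | (forall e, 0 <= rho e) /\
             (forall gamma, Gamma gamma -> 1 <= dotf gamma rho)]%classic.

Definition extreme_points (K : set {ffun E -> R}) : set {ffun E -> R} :=
  [set x : {ffun E -> R} | K x /\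
     (forall (y z : {ffun E -> R}) (t : R), K y -> K z -> 0 < t < 1 ->
        (forall e, x e = t * y e + (1 - t) * z e) -> y = x /\ z = x)]%classic.

Definition blocker Gamma : set {ffun E -> R} := extreme_points (adm Gamma).

Definition energy2 rho : R := \sum_e rho e ^+ 2.

Definition mod2 Gamma : R := inf (energy2 @` adm Gamma)%classic.

Definition minimizer2 Gamma rho : Prop :=
  adm Gamma rho /\ energy2 rho = mod2 Gamma.

Definition optimal_density Gamma rho : Prop :=
  unique (minimizer2 Gamma) rho.

End Modulus.

Definition indicator_vec (R : realType) (E : finType) (F : {set E}) :
  {ffun E -> R} := [ffun e => (e \in F)%:R].

Definition hypertree_family (R : realType) (H : hypergraph) :
  set {ffun hedge H -> R} :=
  [set indicator_vec R F | F in [set F | hypertree F]]%classic.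
Arguments hypertree_family : clear implicits.

Definition homogeneous (R : realType) (H : hypergraph) : Prop :=
  exists eta : {ffun hedge H -> R},
    optimal_density (blocker (hypertree_family R H)) eta /\
    (exists c : R, forall e, eta e = c).

(* Main.v *)
(* Write n = |V|, m = |E|. Testing S on the partition into singletons and D on V
   gives S <= m / (n - 1) <= D.  A density eta admissible for the blocker of
   Gamma has scalar product at least 1 with every point of Adm(Gamma), since a
   linear form that is nonnegative on the orthant decreases to an extreme point
   of the polyhedron Adm(Gamma).

   If the optimal density is a constant c, first-order optimality towards a
   hypertree gives c m = n - 1.  Hypertrees meet delta(P) at least |P| - 1 times
   and leave X at least n - |X| times, so the normalised indicators of delta(P)
   and of E \ E[X] are admissible for Gamma; pairing them with c gives
   S >= m / (n - 1) >= D.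

   Conversely suppose D = m / (n - 1).  The maximal tight sets of a maximal
   hyperforest B of F partition V, whence |F| <= D |B|; for the greedy hypertree
   B of a weight rho, Abel summation turns this into rho(E) >= D rho(B), so the
   constant 1 / D is admissible for the blocker.  It is the unique minimizer
   because every admissible eta satisfies sum eta >= n - 1. *)
Require Import Defs.
From mathcomp Require Import all_boot all_order all_algebra.
From mathcomp Require Import reals.
From mathcomp Require Import zify ring lra.

Set Implicit Arguments.
Unset Strict Implicit.
Unset Printing Implicit Defensive.
Import Order.TTheory GRing.Theory Num.Theory.
Local Open Scope ring_scope.

(** * Counting over partitions, and the tight sets of a hyperforest *)

Section Combinatorics.
Variable H : hypergraph.
Implicit Types (X Y : {set vertex H}) (P : {set {set vertex H}})
  (B F : {set hedge H}).

(** A hyperedge is nonempty, so the only part that can contain it is the part of a chosen vertex [x]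
    of it; it crosses exactly when that part fails to contain it. *)
Lemma crossing_edgesE P e : partition P [set: vertex H] ->
  (\sum_(A in P) (ends e \subset A) + (e \in crossing_edges P))%N = 1%N.
Proof.
move=> pP; have /and3P[/eqP covP tP P0] := pP.
have /card_gt0P[x xe] : (0 < #|ends e|)%N by rewrite (leq_trans _ (ends_ge2 e)).
have xP y : y \in cover P by rewrite covP inE.
have sub_pblock A y : A \in P -> y \in A -> A = pblock P y.
  by move=> AP yA; rewrite (def_pblock tP AP yA).
have BP := pblock_mem (xP x).
rewrite (bigD1 (pblock P x)) //= big1 => [|A /andP[AP neA]]; last first.
  apply/eqP; rewrite eqb0; apply: contra neA => /subsetP/(_ x xe) xA.
  by rewrite (sub_pblock A x).
have Bin : pblock P x \in [set A in P | A :&: ends e != set0].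
  by rewrite inE BP; apply/set0Pn; exists x; rewrite inE mem_pblock xP.
rewrite addn0 inE; have [eB|] := boolP (ends e \subset _).
  suff /negbTE -> : ~~ (1 < #|[set A in P | A :&: ends e != set0]|)%N by [].
  rewrite -leqNgt -(cards1 (pblock P x)) subset_leq_card //; apply/subsetP => A.
  rewrite !inE => /andP[AP /set0Pn[y /setIP[yA /(subsetP eB) yB]]].
  by rewrite (sub_pblock A y) // -(sub_pblock _ y BP yB).
case/subsetPn => y ye yB; suff -> : (1 < #|[set A in P | A :&: ends e != set0]|)%N by [].
apply/card_gt1P; exists (pblock P x), (pblock P y); split=> //.
  by rewrite inE pblock_mem //=; apply/set0Pn; exists y; rewrite inE mem_pblock xP.
by apply: contraNneq yB => ->; rewrite mem_pblock.
Qed.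

Lemma card_crossing P F : partition P [set: vertex H] ->
  #|F| = (\sum_(A in P) #|F :&: induced_edges A| + #|F :&: crossing_edges P|)%N.
Proof.
move=> pP; rewrite -!sum1_card.
have sumI (Q : pred (hedge H)) :
  (\sum_(e in F) Q e)%N = (\sum_(e in F :&: [set e | Q e]) 1)%N.
  rewrite [RHS](eq_bigl (fun e => (e \in F) && Q e)) => [|e]; last by rewrite !inE.
  by rewrite big_mkcondr; apply: eq_bigr => e _; case: (Q e).
rewrite (eq_bigr _ (fun e _ => esym (crossing_edgesE e pP))) big_split /=.
rewrite exchange_big /= sumI; congr (_ + _)%N.
  by apply: eq_bigr => A _; rewrite sumI sum1_card.
by apply: eq_bigl => e; rewrite !inE.
Qed.

Lemma sum_card_partition P : partition P [set: vertex H] ->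
  (\sum_(A in P) #|A|.-1 + #|P|)%N = #|vertex H|.
Proof.
move=> pP; rewrite -cardsT (card_partition pP) -sum1_card -big_split /=.
apply: eq_bigr => A AP; rewrite addn1 prednK // card_gt0.
by have /and3P[_ _] := pP; apply: contraNneq => <-.
Qed.

Definition hyperforestb F :=
  [forall X : {set vertex H}, (X != set0) ==> (#|F :&: induced_edges X| <= #|X|.-1)%N].

Lemma hyperforestP F : reflect (hyperforest F) (hyperforestb F).
Proof.
by apply: (iffP forallP) => hF X; [move/implyP: (hF X) | apply/implyP/hF].
Qed.

Lemma hyperforestS F B : B \subset F -> hyperforest F -> hyperforest B.
Proof.
by move=> BF hF X /hF; apply: leq_trans; rewrite subset_leq_card // setSI.
Qed.

Lemma card_induced_edges1 X : (#|X| <= 1)%N -> induced_edges X = set0.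
Proof.
move=> X1; apply/setP => e; rewrite !inE; apply/negbTE.
by apply/negP => /subset_leq_card /leq_trans/(_ X1); rewrite leqNgt ends_ge2.
Qed.

Lemma hyperforest0 : hyperforest (set0 : {set hedge H}).
Proof. by move=> X _; rewrite set0I cards0. Qed.

Definition tight B X := (X != set0) && (#|B :&: induced_edges X| == #|X|.-1).

(** Counting the hyperedges of [B] inside a set is supermodular, while the cardinality is modular;
    the hyperforest bounds on the union and on the nonempty intersection force equality. *)
Lemma tightU B X Y : hyperforest B -> tight B X -> tight B Y ->
  X :&: Y != set0 -> tight B (X :|: Y).
Proof.
move=> hB /andP[X0 /eqP tX] /andP[Y0 /eqP tY] XY0.
have XUY0 : X :|: Y != set0.
  by rewrite setU_eq0 negb_and X0.
rewrite /tight XUY0 eqn_leq hB //=.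
have := hB _ XY0; move: X0 Y0 XY0 XUY0; rewrite -!card_gt0.
have := cardsUI X Y.
have := cardsUI (B :&: induced_edges X) (B :&: induced_edges Y).
have -> : (B :&: induced_edges X) :&: (B :&: induced_edges Y) =
    B :&: induced_edges (X :&: Y).
  by rewrite setIACA setIid; congr (_ :&: _); apply/setP => e; rewrite !inE subsetI.
have : (#|B :&: induced_edges X :|: B :&: induced_edges Y| <=
        #|B :&: induced_edges (X :|: Y)|)%N.
  rewrite subset_leq_card // -setIUr setIS //; apply/subsetP => e; rewrite !inE.
  by case/orP=> /subset_trans; apply; rewrite ?subsetUl ?subsetUr.
lia.
Qed.

Definition tight_parts B := [set X | maxset (tight B) X].

(** Singletons are tight because a hyperedge has at least two vertices, so maximal tight sets cover;
    by [tightU] two of them that meet coincide. *)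
Lemma tight_partsP B : hyperforest B -> partition (tight_parts B) [set: vertex H].
Proof.
move=> hB; apply/and3P; split.
- apply/eqP/setP => x; rewrite inE; apply/bigcupP.
  have [|X maxX sX] := @maxset_exists _ (tight B) [set x].
    by rewrite /tight -card_gt0 card_induced_edges1 cards1 // setI0 cards0.
  by exists X; rewrite ?inE // -sub1set.
- apply/trivIsetP => X Y; rewrite !inE => /maxsetP[tX maxX] /maxsetP[tY maxY].
  apply: contraNT; rewrite -setI_eq0 => XY0.
  have tXY := tightU hB tX tY XY0.
  by rewrite -(maxX _ tXY (subsetUl _ _)) {1}(maxY _ tXY (subsetUr _ _)).
- by rewrite inE; apply/negP => /maxsetP[/andP[]]; rewrite eqxx.
Qed.

Definition maximal_hyperforest F B :=
  [/\ hyperforest B, B \subset F &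
      forall f, f \in F -> f \notin B -> ~ hyperforest (f |: B)].

(** If [f] is in [F] but not in [B], adding it violates the bound at some [X]. This [X] contains [f]
    and is tight for [B], so [f] lies inside a maximal tight set and cannot cross. *)
Lemma tight_parts_crossing F B : maximal_hyperforest F B ->
  F :&: crossing_edges (tight_parts B) = B :&: crossing_edges (tight_parts B).
Proof.
case=> hB BF maxB; apply/eqP; rewrite eqEsubset [X in _ && X]setSI // andbT.
apply/subsetP => f /setIP[fF fP]; rewrite inE fP andbT.
apply/negPn/negP => fB; have /hyperforestP := maxB f fF fB.
case/forallPn => X; rewrite negb_imply -ltnNge => /andP[X0 ltX].
have hX := hB X X0; have fX : ends f \subset X.
  apply: contraLR ltX => fX; rewrite -leqNgt; apply: leq_trans hX.
  rewrite subset_leq_card //; apply/subsetP => e; rewrite !inE.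
  by case: eqP => [->|_ //]; rewrite (negbTE fX) andbF.
have tX : tight B X.
  rewrite /tight X0 eqn_leq hX -ltnS (leq_trans ltX) //.
  have /setIidPl ff : [set f] \subset induced_edges X by rewrite sub1set inE.
  by rewrite setIUl ff cardsU1 -add1n leq_add2r; case: (_ \notin _).
have [A maxA XA] := maxset_exists tX.
have := crossing_edgesE f (tight_partsP hB).
by rewrite fP (bigD1 A) ?inE //= (subset_trans fX XA) addn1.
Qed.

Lemma card_maximal_hyperforest B : hyperforest B ->
  (#|B| + #|tight_parts B|)%N =
  (#|vertex H| + #|B :&: crossing_edges (tight_parts B)|)%N.
Proof.
move=> hB; have pP := tight_partsP hB.
rewrite (card_crossing B pP) -(sum_card_partition pP) addnAC; congr (_ + _ + _)%N.
by apply: eq_bigr => A; rewrite inE => /maxsetP[/andP[_ /eqP ->]].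
Qed.

Lemma card_hyperforest B : hyperforest B -> (#|B| <= #|vertex H|.-1)%N.
Proof.
move=> hB; have V0 : [set: vertex H] != set0.
  by rewrite -card_gt0 cardsT vertex_gt0.
have := hB _ V0; rewrite cardsT; congr (_ <= _)%N; apply: eq_card => e.
by rewrite !inE subsetT andbT.
Qed.

(** All hyperedges crossing the tight parts belong to [B], and partition-connectedness supplies
    enough of them to raise the count from |V| - |P| to |V| - 1. *)
Lemma maximal_hypertree B : partition_connected H ->
  maximal_hyperforest [set: hedge H] B -> hypertree B.
Proof.
move=> Hconn maxB; have [hB _ _] := maxB; split=> //.
apply/eqP; rewrite eqn_leq card_hyperforest //=.
have := Hconn _ (tight_partsP hB); have := card_maximal_hyperforest hB.
rewrite -(tight_parts_crossing maxB) setTI.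
move: #|tight_parts B| #|crossing_edges _| #|B| #|vertex H| => p c k n; lia.
Qed.

Lemma exists_hypertree : partition_connected H -> exists B, hypertree B.
Proof.
move=> Hconn; have /hyperforestP h0 := hyperforest0.
have [B /maxsetP[/hyperforestP hB maxB] _] := maxset_exists h0.
exists B; apply: maximal_hypertree => //; split=> // f _ fB /hyperforestP hf.
by have := maxB _ hf (subsetUr _ _); apply/eqP; apply: contraNneq fB => <-; rewrite setU11.
Qed.

(** The parts contain at most |V| - |P| hyperedges of [B] in total, and the remaining ones cross. *)
Lemma hypertree_crossing B P : hypertree B -> partition P [set: vertex H] ->
  (#|P|.-1 <= #|B :&: crossing_edges P|)%N.
Proof.
case=> hB cB pP; have /and3P[_ _ P0] := pP.
have := card_crossing B pP; have := sum_card_partition pP; rewrite cB.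
have : (\sum_(A in P) #|B :&: induced_edges A| <= \sum_(A in P) #|A|.-1)%N.
  by apply: leq_sum => A AP; apply: hB; apply: contraNneq P0 => <-.
have := vertex_gt0 H; lia.
Qed.

(** * The greedy hypertree of a weight *)

Section Greedy.
Variables (R : realType) (D : R) (rho : hedge H -> R).
Hypothesis D1 : 1 <= D.
Hypothesis denseD :
  forall X, X != set0 -> #|induced_edges X|%:R <= D * #|X|.-1%:R.

(** Inside a tight part [A], [B] has exactly |A| - 1 hyperedges, so [denseD] bounds those of [F];
    across the parts [F] and [B] agree, and [D1] suffices. *)
Lemma card_le_maximal F B : maximal_hyperforest F B -> #|F|%:R <= D * #|B|%:R.
Proof.
move=> maxB; have [hB BF _] := maxB; have pP := tight_partsP hB.
rewrite (card_crossing F pP) (card_crossing B pP) (tight_parts_crossing maxB).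
rewrite !natrD mulrDr lerD //; last by rewrite ler_peMl.
rewrite !natr_sum mulr_sumr ler_sum // => A.
rewrite inE => /maxsetP[/andP[A0 /eqP ->] _]; apply: le_trans (denseD A0).
by rewrite ler_nat subset_leq_card // subsetIr.
Qed.

(* The last conclusion is Abel summation for the greedy hyperforest, with the
   bound [M] in place of the last value of [rho] so that it can be proved by
   induction. *)
Lemma greedy (s : seq (hedge H)) : uniq s -> pairwise (relpre rho <=%R) s ->
  exists2 B, maximal_hyperforest [set e in s] B &
    forall M, {in s, forall e, rho e <= M} ->
      M * ((size s)%:R - D * #|B|%:R) <=
        \sum_(e <- s) rho e - D * \sum_(e in B) rho e.
Proof.
elim/last_ind: s => [_ _|s x IHs].
  exists set0; first by split=> [||f]; [exact: hyperforest0 | exact: sub0set | rewrite inE].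
  by move=> M _; rewrite big_nil big_set0 cards0 !mulr0 subrr mulr0.
rewrite rcons_uniq pairwise_rcons => /andP[xs us] /andP[/allP/= sx ss].
have [B maxB leB] := IHs us ss; have [hB Bs noB] := maxB.
have {}leB := leB (rho x) sx.
have xB : x \notin B by apply: contraNN xs => /(subsetP Bs); rewrite inE.
have cs : #|[set e in rcons s x]| = (size s).+1.
  by rewrite cardsE (card_uniqP _) ?size_rcons // rcons_uniq xs.
(* The greedy choice: [x] is kept whenever the result is still a hyperforest. *)
pose B' := if hyperforestb (x |: B) then x |: B else B.
have maxB' : maximal_hyperforest [set e in rcons s x] B'.
  rewrite /B'; case: (hyperforestP (x |: B)) => hx; split=> //.
  - apply/subsetP => e; rewrite !inE mem_rcons inE => /orP[->//|/(subsetP Bs)].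
    by rewrite inE => ->; rewrite orbT.
  - move=> f; rewrite !inE mem_rcons inE negb_or => /orP[->//|fs] /andP[_ fB].
    move/hyperforestS => hf; apply: (noB f); rewrite ?inE //; apply: hf.
    by rewrite setUS // subsetUr.
  - apply/subsetP => e /(subsetP Bs); rewrite !inE mem_rcons inE => ->.
    by rewrite orbT.
  - move=> f; rewrite inE mem_rcons inE => /orP[/eqP->//|fs].
    by apply: noB; rewrite inE.
exists B' => // M hM; have xM : rho x <= M by apply: hM; rewrite mem_rcons mem_head.
have := card_le_maximal maxB'; rewrite cs => cB'.
(* The bracket is nonpositive by [card_le_maximal], so lowering [M] to [rho x] can only increase the
   product. *)
have le1 : M * ((size s).+1%:R - D * #|B'|%:R) <=
    rho x * ((size s).+1%:R - D * #|B'|%:R).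
  by rewrite ler_wnM2r // subr_le0.
rewrite size_rcons (le_trans le1) // -cats1 big_cat big_seq1 /=.
rewrite -natr1 /B'; case: ifP => _; last first.
  by rewrite addrAC mulrDr mulr1 [leRHS]addrAC lerD2r.
rewrite big_setU1 //= cardsU1 xB natrD.
have -> (a b : R) : a + 1 - D * (1 + b) = a - D * b + (1 - D) by ring.
have -> (a b : R) : a + rho x - D * (rho x + b) = a - D * b + rho x * (1 - D) by ring.
by rewrite mulrDr lerD2r.
Qed.

Lemma hypertree_below : partition_connected H ->
  #|hedge H|%:R = D * #|vertex H|.-1%:R ->
  exists2 B, hypertree B & D * \sum_(e in B) rho e <= \sum_e rho e.
Proof.
move=> Hconn mD; pose s := sort (relpre rho <=%R) (index_enum (hedge H)).
have us : uniq s by rewrite sort_uniq index_enum_uniq.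
have ss : pairwise (relpre rho <=%R) s.
  rewrite -sorted_pairwise => [|f e g]; last exact: le_trans.
  by apply: sort_sorted => e f; apply: le_total.
have [B maxB leB] := greedy us ss.
have sT : [set e in s] = setT.
  by apply/setP => e; rewrite !inE mem_sort mem_index_enum.
rewrite sT in maxB; have hB := maximal_hypertree Hconn maxB; exists B => //.
(* Any upper bound will do: the coefficient of [M] vanishes by [mD]. *)
have [M hM] : exists M, forall e, rho e <= M.
  exists (\sum_e `|rho e|) => e; rewrite (bigD1 e) //= (le_trans (ler_norm _)) //.
  by rewrite lerDl sumr_ge0.
have := leB M (fun e _ => hM e); rewrite (proj2 hB).
have -> : size s = #|hedge H| by rewrite size_sort cardT enumT.
rewrite mD subrr mulr0 subr_ge0 => /le_trans; apply.
by rewrite (perm_big (index_enum (hedge H))) //= perm_sort.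
Qed.

End Greedy.
End Combinatorics.

From mathcomp Require Import boolp classical_sets.

(** * Extreme points of polyhedra, blocking duality and minimizers *)

Section Duality.
Variables (R : realType) (E : finType).
Implicit Types (x y z d eta rho gamma : {ffun E -> R}) (K Gamma : set {ffun E -> R}).

Lemma dotfC gamma rho : dotf gamma rho = dotf rho gamma.
Proof. by apply: eq_bigr => e _; rewrite mulrC. Qed.

Lemma dotf_lin gamma x y (s t : R) :
  dotf gamma [ffun e => s * x e + t * y e] = s * dotf gamma x + t * dotf gamma y.
Proof.
rewrite /dotf !mulr_sumr -big_split /=; apply: eq_bigr => e _.
by rewrite ffunE; ring.
Qed.

Section Polyhedron.
Variables (I : finType) (a : I -> {ffun E -> R}) (b : I -> R).

Let tight x := [set i | dotf (a i) x == b i].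

(** The ratio test of the simplex method: [t] is the least quotient of slack by rate of decrease, so
    the minimizing constraint becomes tight first. The factor [1] gives the shape of [dotf_lin]. *)
Lemma tight_increase x d : (forall i, b i <= dotf (a i) x) ->
    (forall i, i \in tight x -> dotf (a i) d = 0) ->
    (exists i, dotf (a i) d < 0) ->
  exists t : R, [/\ 0 <= t, forall i, b i <= dotf (a i) [ffun e => 1 * x e + t * d e] &
    (#|tight x| < #|tight [ffun e => 1 * x e + t * d e]%R|)%N].
Proof.
move=> Kx td [i0 di0].
pose slope i := (dotf (a i) x - b i) / - dotf (a i) d.
case: (@arg_minP _ _ _ i0 (fun i => dotf (a i) d < 0) slope di0) => i di mini.
have slope0 : 0 <= slope i by rewrite divr_ge0 ?subr_ge0 ?oppr_ge0 // ltW.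
exists (slope i); split=> // [j|].
  rewrite dotf_lin; have [dj|dj] := ltP (dotf (a j) d) 0.
    have := mini j dj; rewrite {2}/slope ler_pdivlMr ?oppr_gt0 //; lra.
  by have := mulr_ge0 slope0 dj; have := Kx j; lra.
apply: proper_card; apply/properP; split.
  apply/fintype.subsetP => j jx; have := td j jx; rewrite !inE dotf_lin => ->.
  by rewrite mulr0 addr0 mul1r; rewrite inE in jx.
exists i; rewrite ?inE; last first.
  by apply/negP => ix; have := td i; rewrite inE => /(_ ix) d0; rewrite d0 ltxx in di.
rewrite dotf_lin /slope; apply/eqP; field; lra.
Qed.

(* Induction on the number of slack constraints: a point that is not extreme can
   be moved, without increasing [dotf eta], along a direction in which all tight
   constraints are constant, until one more becomes tight. *)
Lemma extreme_point_below K eta x :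
    (forall y, K y <-> forall i, b i <= dotf (a i) y) ->
    (forall d, (forall i, 0 <= dotf (a i) d) -> 0 <= dotf eta d) ->
    (forall d, (forall i, dotf (a i) d = 0) -> forall e, d e = 0) -> K x ->
  exists2 y, extreme_points K y & dotf eta y <= dotf eta x.
Proof.
move=> KP bounded pointed.
have [k] := ubnP (#|I| - #|tight x|); elim: k x => // k IHk x ltk Kx.
have [|nx] := EM (extreme_points K x); first by exists x.
have [y [z [t [Ky Kz t01 xyz nyz]]]] : exists y z (t : R), [/\ K y, K z, 0 < t < 1,
    forall e, x e = t * y e + (1 - t) * z e & ~ (y = x /\ z = x)].
  apply: contra_notP nx => nx; split=> // y z t Ky Kz t01 xyz.
  by apply: contra_notP nx => nyz; exists y, z, t.
have /andP[t0 t1] := t01.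
have Kx' := (KP x).1 Kx.
pose d := [ffun e => 1 * y e + -1 * z e].
(* The value at [x] is a proper average of two values that are at least [b i]; if it equals [b i],
   so do both. *)
have td i : i \in tight x -> dotf (a i) d = 0.
  have -> : x = [ffun e => t * y e + (1 - t) * z e] by apply/ffunP => e; rewrite ffunE.
  rewrite inE !dotf_lin => /eqP ti.
  have := (KP y).1 Ky i; have := (KP z).1 Kz i; nra.
have nd : ~ forall e, d e = 0.
  apply: contra_not nyz => d0; split; apply/ffunP => e; have := xyz e;
  by have := d0 e; rewrite ffunE => ?; nra.
(* Either [d] or its opposite works. If no constraint decreases along [d], take the opposite:
   [bounded] controls [eta] and [pointed] yields a decreasing constraint. Otherwise the sign of
   [dotf eta d] decides. *)
have [d' [td' neg le0]] : exists d', [/\ forall i, i \in tight x -> dotf (a i) d' = 0,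
    exists i, dotf (a i) d' < 0 & dotf eta d' <= 0].
  have ndotf (g : {ffun E -> R}) : dotf g [ffun e => -1 * d e + 0 * d e] = - dotf g d.
    by rewrite dotf_lin; lra.
  pose nd' := [ffun e => -1 * d e + 0 * d e].
  have tnd i : i \in tight x -> dotf (a i) nd' = 0 by move/td; rewrite ndotf => ->; rewrite oppr0.
  have lt0P (d' : {ffun E -> R}) : ~ (forall i, 0 <= dotf (a i) d') -> exists i, dotf (a i) d' < 0.
    by move=> /existsNP[i /negP]; rewrite -ltNge; exists i.
  have [p|/lt0P n] := EM (forall i, 0 <= dotf (a i) d).
    exists nd'; split=> //; last by rewrite ndotf oppr_le0 bounded.
    apply: lt0P => n; apply: nd; apply: pointed => i.
    by have := p i; have := n i; rewrite ndotf; lra.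
  have [ed|ed] := leP (dotf eta d) 0; first by exists d.
  exists nd'; split=> //; last by rewrite ndotf; lra.
  by apply: lt0P => p; have := bounded _ p; rewrite ndotf; lra.
have [u [u0 Ku ltu]] := tight_increase Kx' td' neg.
have [||w Ew le_w] := IHk [ffun e => 1 * x e + u * d' e].
- by have := max_card (tight [ffun e => 1 * x e + u * d' e]); lia.
- exact/KP.
exists w => //; apply: le_trans le_w _; rewrite dotf_lin; nra.
Qed.

End Polyhedron.

(* Only the finiteness of [Gamma] matters: it makes [adm Gamma] a polyhedron. *)
Lemma dotf_adm_blocker (J : finType) (g : J -> {ffun E -> R}) Gamma eta rho :
    Gamma = range g ->
    adm (blocker Gamma) eta -> adm Gamma rho -> 1 <= dotf eta rho.
Proof.
move=> -> [eta0 eta1] Arho.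
(* The indices [inl e] encode nonnegativity of the coordinates, the indices [inr j] the constraints
   from [g]. *)
pose a i := match i with inl e => [ffun f => (f == e)%:R] | inr j => g j end.
pose b (i : E + J) : R := match i with inl _ => 0 | inr _ => 1 end.
have dote (x : {ffun E -> R}) e : dotf [ffun f => (f == e)%:R] x = x e.
  rewrite /dotf (bigD1 e) //= ffunE eqxx mul1r big1 ?addr0 // => f /negbTE fe.
  by rewrite ffunE fe mul0r.
have [|||y Ey le_y] := @extreme_point_below _ a b (adm (range g)) eta rho _ _ _ Arho.
- move=> y; split=> [[y0 y1] [e|j]|Ky]; rewrite /= ?dote //; first by apply: y1; exists j.
  by split=> [e|_ [j _ <-]]; [have := Ky (inl e); rewrite /= dote | exact: (Ky (inr j))].
- move=> d d0; apply: sumr_ge0 => e _; rewrite mulr_ge0 //.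
  by have := d0 (inl e); rewrite /= dote.
- by move=> d d0 e; have := d0 (inl e); rewrite /= dote.
by rewrite (le_trans _ le_y) // dotfC eta1.
Qed.

Lemma adm_blocker Gamma gamma :
  Gamma gamma -> (forall e, 0 <= gamma e) -> adm (blocker Gamma) gamma.
Proof. by move=> Gg g0; split=> // rho [[_ Arho] _]; rewrite dotfC Arho. Qed.

Lemma adm_convex Gamma x y (t : R) : 0 <= t <= 1 -> adm Gamma x -> adm Gamma y ->
  adm Gamma [ffun e => (1 - t) * x e + t * y e].
Proof.
move=> /andP[t0 t1] [x0 x1] [y0 y1]; split=> [e|gamma Gg].
  by rewrite ffunE addr_ge0 // mulr_ge0 // subr_ge0.
rewrite dotf_lin; have := x1 _ Gg; have := y1 _ Gg; nra.
Qed.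

Lemma minimizer2P Gamma eta : minimizer2 Gamma eta <->
  adm Gamma eta /\ (forall rho, adm Gamma rho -> energy2 eta <= energy2 rho).
Proof.
have en0 rho : 0 <= energy2 rho by apply: sumr_ge0 => e _; exact: sqr_ge0.
have lb : has_lbound (@energy2 R E @` adm Gamma)%classic by exists 0 => _ [rho _ <-].
split=> -[Aeta min]; split=> //.
  by move=> rho Arho; rewrite min; apply: ge_inf => //; exists rho.
apply/eqP; rewrite eq_le; apply/andP; split.
  by apply: lb_le_inf => [|_ [rho /min h <-]//]; exists (energy2 eta), eta.
by apply: ge_inf => //; exists eta.
Qed.

Lemma dotf_const gamma (c : R) : dotf gamma [ffun=> c] = c * \sum_e gamma e.
Proof. by rewrite mulr_sumr; apply: eq_bigr => e _; rewrite ffunE mulrC. Qed.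

Lemma dotf_indicator (F : {set E}) rho :
  dotf (indicator_vec R F) rho = \sum_(e in F) rho e.
Proof.
rewrite /dotf [RHS]big_mkcond; apply: eq_bigr => e _; rewrite ffunE.
by case: ifP => _; rewrite ?mul1r ?mul0r.
Qed.

End Duality.

Lemma natr_predn (R : realType) k : (0 < k)%N -> k.-1%:R = k%:R - 1 :> R.
Proof. by move=> k0; rewrite -subn1 natrB. Qed.

(** * Densities admissible for the blocker of the hypertree family *)

Section Hypertrees.
Variables (R : realType) (H : hypergraph).
Local Notation Gamma := (hypertree_family R H).
Implicit Types (rho eta : {ffun hedge H -> R}) (C : {set hedge H}).

Lemma hypertree_family_finite :
  exists (J : finType) (g : J -> {ffun hedge H -> R}), Gamma = range g.
Proof.
pose Q (F : {set hedge H}) := hyperforestb F && (#|F| == #|vertex H|.-1).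
have QP F : Q F <-> hypertree F.
  by split=> [/andP[/hyperforestP ? /eqP ?]|[/hyperforestP ? /eqP ?]]; [split | apply/andP].
exists {F | Q F}, (fun j => indicator_vec R (val j)); apply/seteqP; split=> x /=.
  by case=> F /QP QF <-; exists (exist _ F QF).
by case=> -[F QF] _ <-; exists F => //; apply/QP.
Qed.

Lemma hypertree_duality eta rho :
  adm (blocker Gamma) eta -> adm Gamma rho -> 1 <= dotf eta rho.
Proof. by have [J [g]] := hypertree_family_finite; apply: dotf_adm_blocker. Qed.

(** The indicator of [C] divided by [k] is admissible for the hypertree family; duality pairs it
    with [eta]. *)
Lemma hitting_set_bound C k eta : (0 < k)%N ->
    (forall B, hypertree B -> (k <= #|B :&: C|)%N) ->
    adm (blocker Gamma) eta -> k%:R <= \sum_(e in C) eta e.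
Proof.
move=> k0 hitC Aeta; have k0R : 0 < k%:R :> R by rewrite ltr0n.
pose rho : {ffun hedge H -> R} := [ffun e => (e \in C)%:R / k%:R].
have /(hypertree_duality Aeta) : adm Gamma rho.
  split=> [e|_ [B hB <-]]; first by rewrite ffunE divr_ge0.
  rewrite dotf_indicator; under eq_bigr do rewrite ffunE.
  rewrite -mulr_suml ler_pdivlMr // mul1r -natr_sum ler_nat (leq_trans (hitC B hB)) //.
  rewrite -sum1_card (eq_bigl (fun e => (e \in B) && (e \in C))) => [|e]; last by rewrite inE.
  by rewrite big_mkcondr leq_sum // => e _; case: (e \in C).
suff -> : dotf eta rho = (\sum_(e in C) eta e) / k%:R by rewrite ler_pdivlMr // mul1r.
rewrite mulr_suml [RHS]big_mkcond; apply: eq_bigr => e _; rewrite ffunE.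
by case: (e \in C); rewrite ?mul0r ?mulr0 ?mul1r.
Qed.

Lemma crossing_singletons : crossing_edges (singletons H) = [set: hedge H]%SET.
Proof.
apply/setP => e; have := crossing_edgesE e (singletons_partition H).
rewrite big1 => [|A /imsetP[x _ ->]]; first by rewrite finset.in_setT; case: (e \in _).
apply/eqP; rewrite eqb0; apply/negP => /subset_leq_card.
by rewrite cards1 leqNgt ends_ge2.
Qed.

Lemma cut_ratio_singletons :
  cut_ratio R (singletons H) = #|hedge H|%:R / (#|vertex H|%:R - 1).
Proof. by rewrite /cut_ratio crossing_singletons cardsT card_singletons. Qed.

Lemma density_ratio_setT :
  density_ratio R [set: vertex H]%SET = #|hedge H|%:R / (#|vertex H|%:R - 1).
Proof.
rewrite /density_ratio cardsT (_ : induced_edges _ = [set: hedge H]%SET) ?cardsT //.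
by apply/setP => e; rewrite !inE finset.subsetT.
Qed.

Section Connected.
Hypothesis Hconn : partition_connected H.
Hypothesis HV : (2 <= #|vertex H|)%N.
Local Notation m := (#|hedge H|%:R : R).
Local Notation n := (#|vertex H|%:R : R).

Lemma n_gt1 : 1 < n.
Proof. by rewrite ltr1n. Qed.

Lemma n_le_m : n - 1 <= m.
Proof.
have := Hconn (singletons_partition H).
by rewrite crossing_singletons cardsT card_singletons -natr_predn ?ler_nat // ltnW.
Qed.

Lemma sum_adm_blocker eta : adm (blocker Gamma) eta -> n - 1 <= \sum_e eta e.
Proof.
move=> Aeta; have := @hitting_set_bound [set: hedge H]%SET #|vertex H|.-1 eta.
rewrite natr_predn ?(ltnW HV) //.
rewrite [\sum_(e in _) _](eq_bigl xpredT) => [|e]; last by rewrite inE.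
apply=> // [|B [_ cB]]; last by rewrite finset.setIT cB.
by rewrite -subn1 subn_gt0.
Qed.

(** Completing the square at [c] turns a lower bound on the sum of [z] into one on its energy. *)
Lemma energy2_shift (c : R) (z : {ffun hedge H -> R}) :
  energy2 z = \sum_e (z e - c) ^+ 2 + 2 * c * \sum_e z e - c ^+ 2 * m.
Proof.
rewrite /energy2 mulr_sumr -sum1_card natr_sum mulr_sumr -big_split -sumrB /=.
by apply: eq_bigr => e _; ring.
Qed.

Lemma energy2_const (c : R) : energy2 ([ffun=> c] : {ffun hedge H -> R}) = c ^+ 2 * m.
Proof.
rewrite /energy2 -sum1_card natr_sum mulr_sumr.
by apply: eq_bigr => e _; rewrite ffunE mulr1.
Qed.

(* First-order optimality of the constant [c] along the segment towards the
   indicator vector of a hypertree. *)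
Lemma homogeneous_density (c : R) :
  minimizer2 (blocker Gamma) [ffun=> c] -> c * m = n - 1.
Proof.
move=> /minimizer2P[Ac minc].
have [B hB] := exists_hypertree Hconn.
pose z := indicator_vec R B; have z0 e : 0 <= z e by rewrite ffunE.
have Az : adm (blocker Gamma) z by apply: adm_blocker => //; exists B.
have sz : \sum_e z e = n - 1.
  have := dotf_indicator B [ffun=> 1 : R]; rewrite dotf_const mul1r => ->.
  rewrite -natr_predn ?(ltnW HV) // -(proj2 hB) -sum1_card natr_sum.
  by apply: eq_bigr => e _; rewrite ffunE.
have sc : \sum_(e : hedge H) c = c * m.
  by rewrite -sum1_card natr_sum mulr_sumr; apply: eq_bigr => e _; rewrite mulr1.
have cm : n - 1 <= c * m.
  have := sum_adm_blocker Ac.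
  by rewrite (eq_bigr (fun=> c)) ?sc // => e _; rewrite ffunE.
have n1 := n_gt1; have m0 : 0 < m by have := n_le_m; lra.
have c0 : 0 < c by rewrite -(pmulr_lgt0 _ m0); lra.
apply: le_anti; rewrite cm andbT.
set V := \sum_e (z e - c) ^+ 2.
have V0 : 0 <= V by apply: sumr_ge0 => e _; exact: sqr_ge0.
have step t : 0 <= t <= 1 -> 0 <= t * (t * V + 2 * c * (n - 1 - c * m)).
  move=> t01; have := minc _ (adm_convex t01 Ac Az).
  rewrite energy2_const (energy2_shift c).
  under eq_bigr do rewrite !ffunE.
  rewrite (_ : \sum_e _ = t ^+ 2 * V); last first.
    by rewrite mulr_sumr; apply: eq_bigr => e _; rewrite /z ffunE; ring.
  under eq_bigr do rewrite !ffunE.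
  rewrite big_split /= -!mulr_sumr sc.
  rewrite (eq_bigr z) => [|e _]; last by rewrite ffunE.
  rewrite sz; lra.
rewrite leNgt; apply/negP => lt.
(* For t = a / (V + a) one has t V <= a, whereas [step] requires t V >= 2 a. Adding [a] keeps the
   denominator positive even if [V] is zero. *)
pose a := c * (c * m - (n - 1)); have a0 : 0 < a by rewrite mulr_gt0 // subr_gt0.
have Va : 0 < V + a by lra.
have t0 : 0 < a / (V + a) by rewrite divr_gt0.
have t1 : a / (V + a) <= 1 by rewrite ler_pdivrMr //; lra.
have := step (a / (V + a)); rewrite t1 ltW // => /(_ isT).
rewrite pmulr_rge0 //.
have : a / (V + a) * V <= a by rewrite mulrAC ler_pdivrMr // ler_pM2l //; lra.
rewrite {3}/a; move: a0; rewrite /a; lra.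
Qed.

End Connected.
End Hypertrees.

(** * Homogeneity against equality of strength and fractional arboricity *)

Theorem theorem1p9 (R : realType) (H : hypergraph)
  (Hconn : partition_connected H) (HV : (2 <= #|vertex H|)%N) :
  homogeneous R H <-> strength H R = frac_arboricity H R.
Proof.
pose m : R := #|hedge H|%:R; pose n : R := #|vertex H|%:R.
have n1 : 0 < n - 1 by rewrite subr_gt0 n_gt1.
have nm : n - 1 <= m by exact: n_le_m.
have m0 : 0 < m by lra.
have [[P [pP P2 SP]] minS] := strengthP R HV.
have [[X [X2 DX]] maxD] := frac_arboricityP R HV.
have leS : strength H R <= m / (n - 1).
  by rewrite -cut_ratio_singletons minS ?singletons_partition ?card_singletons.
have leD : m / (n - 1) <= frac_arboricity H R.
  by rewrite -density_ratio_setT maxD // cardsT.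
split=> [[eta [[mineta _] [c etac]]]|SD].
  have {eta etac} mineta : minimizer2 (blocker (hypertree_family R H)) [ffun=> c].
    by rewrite (_ : [ffun=> c] = eta) //; apply/ffunP => e; rewrite ffunE etac.
  have cm : c * m = n - 1 := homogeneous_density Hconn HV mineta.
  have c0 : 0 < c by rewrite -(pmulr_lgt0 _ m0); lra.
  have mn : m / (n - 1) = c^-1 by rewrite -cm invfM mulrCA divff ?mulr1 ?gt_eqF.
  have [Ac _] := mineta.
  have sumc (C : {set hedge H}) : \sum_(e in C) [ffun=> c] e = c * #|C|%:R.
    rewrite -sum1_card natr_sum mulr_sumr.
    by apply: eq_bigr => e _; rewrite ffunE mulr1.
  apply: le_anti; rewrite (le_trans leS leD) /=.
  apply: (@le_trans _ _ c^-1).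
    rewrite DX /density_ratio ler_pdivrMr ?subr_gt0 ?ltr1n //.
    rewrite ler_pdivlMl //.
    (* The case X = V is separate because [hitting_set_bound] requires a positive [k], here |V| -
       |X|. *)
    have [XV|XV] := ltnP #|X| #|vertex H|; last first.
      have -> : #|X|%:R = n by apply/eqP; rewrite eqr_nat eqn_leq XV max_card.
      by rewrite -cm ler_pM2l // ler_nat max_card.
    have := @hitting_set_bound R H (~: induced_edges X) (#|vertex H| - #|X|) _ _ _ Ac.
    rewrite sumc subn_gt0 XV natrB 1?ltnW // => /(_ isT).
    have : #|induced_edges X|%:R + #|~: induced_edges X|%:R = m.
      by rewrite -natrD cardsC.
    move=> mE; have := cm; rewrite -mE mulrDr => {}cm.
    suff hit B : hypertree B -> (#|vertex H| - #|X| <= #|B :&: ~: induced_edges X|)%N.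
      by move=> /(_ hit); move: cm; rewrite -/n; lra.
    move=> [hB cB]; have X0 : X != finset.set0 by rewrite -card_gt0 (ltnW X2).
    have := hB X X0; have := cardsID (induced_edges X) B; rewrite finset.setDE cB.
    move: #|B :&: induced_edges X|%SET #|B :&: ~: induced_edges X|%SET X2 => i j; lia.
  rewrite SP /cut_ratio ler_pdivlMr ?subr_gt0 ?ltr1n // mulrC ler_pdivrMr // mulrC.
  rewrite -sumc -natr_predn ?(ltnW P2) //; apply: hitting_set_bound => //.
    by rewrite -subn1 subn_gt0.
  by move=> B hB; apply: hypertree_crossing.
have DE : frac_arboricity H R = m / (n - 1) by apply: le_anti; rewrite leD -SD leS.
set D := m / (n - 1) in DE; have D1 : 1 <= D by rewrite ler_pdivlMr // mul1r.
have D0 : 0 < D by lra.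
have mD : m = D * (n - 1) by rewrite divfK ?gt_eqF.
have denseD (Y : {set vertex H}) : Y != finset.set0 ->
    #|induced_edges Y|%:R <= D * #|Y|.-1%:R.
  move=> Y0; have [Y1|Y1] := leqP #|Y| 1.
    by rewrite card_induced_edges1 // cards0 mulr_ge0 // ltW.
  rewrite natr_predn ?card_gt0 // -ler_pdivrMr ?subr_gt0 ?ltr1n //.
  by rewrite -DE; apply: maxD.
have c0 : 0 < D^-1 by rewrite invr_gt0.
pose eta : {ffun hedge H -> R} := [ffun=> D^-1].
have Aeta : adm (blocker (hypertree_family R H)) eta.
  split=> [e|rho [[rho0 rho1] _]]; first by rewrite ffunE ltW.
  have [|B hB leB] := hypertree_below rho D1 denseD Hconn.
    by rewrite natr_predn ?(ltnW HV).
  rewrite dotf_const mulrC ler_pdivlMr // mul1r (le_trans _ leB) // ler_peMr ?(ltW D0) //.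
  by rewrite -dotf_indicator rho1 //; exists B.
(* As the sum of [z] is at least n - 1 = m / D, completing the square at 1 / D leaves the squared
   distance to [eta] as surplus; this gives both minimality and uniqueness. *)
have gap z : adm (blocker (hypertree_family R H)) z ->
    energy2 eta + \sum_e (z e - D^-1) ^+ 2 <= energy2 z.
  move=> Az; have := sum_adm_blocker HV Az; rewrite -/n => sz.
  rewrite energy2_const (energy2_shift D^-1 z) -/m.
  have -> : D^-1 ^+ 2 * m = D^-1 * (n - 1) by rewrite mD; field; lra.
  have := mulr_ge0 (ltW c0) (_ : 0 <= \sum_e z e - (n - 1)); rewrite subr_ge0 => /(_ sz).
  lra.
have sq0 (z : {ffun hedge H -> R}) e : 0 <= (z e - D^-1) ^+ 2 by exact: sqr_ge0.
have mineta : minimizer2 (blocker (hypertree_family R H)) eta.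
  apply/minimizer2P; split=> // z /gap; apply: le_trans.
  by rewrite lerDl sumr_ge0.
exists eta; split; last by exists D^-1 => e; rewrite ffunE.
split=> // z [Az minz]; have := gap z Az.
rewrite minz (proj2 mineta) gerDl => le0; apply/ffunP => e; rewrite ffunE.
have : \sum_e (z e - D^-1) ^+ 2 == 0 by rewrite eq_le le0 sumr_ge0.
rewrite psumr_eq0 // => /allP/(_ e (mem_index_enum e)).
by rewrite /= sqrf_eq0 subr_eq0 => /eqP.
Qed.
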